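(* Let $A$ be a finite dimensional self-injective algebra over a field $k$, let $M$ be a finitely generated left $A$-module and let $\mathbf T=(T_n,d_n^{\mathbf T})_{n\in\mathbb Z}$ be a complete resolution of $M$. Then the following statements are equivalent. (1) $\mathbf T$ is a minimal complete resolution of $M$. (2) For all $n\in\mathbb Z$, $T_n$ is a projective cover of $\mathrm{Coker}\,d_{n+1}^{\mathbf T}$ (via the canonical epimorphism $T_n\to\mathrm{Coker}\,d_{n+1}^{\mathbf T}$).
   Context: A finite dimensional algebra $A$ is self-injective if it is injective as a left (equivalently right) module over itself. Over such $A$, a complete resolution of a finitely generated $A$-module $M$ is an acyclic chain complex $\mathbf T=(T_i,d_i)_{i\in\mathbb Z}$ (with $d_i:T_i\to T_{i-1}$) of finitely generated projective $A$-modules together with a factorization $d_0=\eta\varepsilon$ with $\varepsilon:T_0\to M$ surjective and $\eta:M\to T_{-1}$ injective (so that $M\cong\mathrm{Coker}\,d_1$, and $T_{\ge0}\xrightarrow{\varepsilon}M$ is a projective resolution; the complex $\mathrm{Hom}_A(\mathbf T,A)$ is then automatically acyclic). A chain complex $C$ is minimal if every homotopy equivalence $C\to C$ is an isomorphism; a complete resolution is minimal if the complex $\mathbf T$ is minimal. *)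

(* Defs.v *)
(* boolp makes membership in the image of a linear map boolean. *)
From HB Require Import structures.
From mathcomp Require Import all_boot all_algebra.
From mathcomp Require Import boolp.

Set Implicit Arguments.
Unset Strict Implicit.
Unset Printing Implicit Defensive.

Import GRing.Theory.
Local Open Scope ring_scope.
Local Open Scope quotient_scope.

Section Cokernel.
Variables (A : nzRingType) (U V : lmodType A) (f : {linear U -> V}).

Definition lin_image : {pred V} := fun y => `[< exists x, f x = y >].

Fact lin_image_submod_closed : submod_closed lin_image.
Proof.
split; first by apply/asboolP; exists 0; rewrite linear0.
move=> a _ _ /asboolP[x <-] /asboolP[y <-].
by apply/asboolP; exists (a *: x + y); rewrite linearP.
Qed.

HB.instance Definition _ := GRing.isSubmodClosed.Build A V lin_image
  (GRing.submod_closed_semi lin_image_submod_closed).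

Definition coker : Type := Quotient.quot lin_image.

HB.instance Definition _ := GRing.Zmodule.on coker.

Definition coker_proj (y : V) : coker := \pi_(Quotient.quot lin_image) y.

Definition coker_scale (a : A) (c : coker) : coker := coker_proj (a *: repr c).

Lemma coker_projD : {morph coker_proj : x y / x + y}.
Proof. by move=> x y; rewrite /coker_proj raddfD. Qed.

Lemma coker_proj_eq x y : (coker_proj x == coker_proj y) = (x - y \in lin_image).
Proof. by rewrite Quotient.idealrBE. Qed.

Lemma coker_proj_repr (c : coker) : coker_proj (repr c) = c.
Proof. exact: reprK. Qed.

Lemma coker_projZ a x : coker_proj (a *: x) = coker_scale a (coker_proj x).
Proof.
apply/eqP; rewrite coker_proj_eq -scalerBr rpredZ //.
by rewrite -coker_proj_eq coker_proj_repr.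
Qed.

Fact coker_scaleA a b c :
  coker_scale a (coker_scale b c) = coker_scale (a * b) c.
Proof. by rewrite -[c]coker_proj_repr -!coker_projZ scalerA. Qed.

Fact coker_scale1 : left_id 1 coker_scale.
Proof. by move=> c; rewrite -[c]coker_proj_repr -coker_projZ scale1r. Qed.

Fact coker_scaleDr : right_distributive coker_scale +%R.
Proof.
move=> a c d; rewrite -[c]coker_proj_repr -[d]coker_proj_repr.
by rewrite -coker_projD -!coker_projZ -coker_projD scalerDr.
Qed.

Fact coker_scaleDl c : {morph coker_scale^~ c : a b / a + b}.
Proof.
by move=> a b; rewrite -[c]coker_proj_repr -!coker_projZ -coker_projD scalerDl.
Qed.

HB.instance Definition _ := GRing.Zmodule_isLmodule.Build A coker
  coker_scaleA coker_scale1 coker_scaleDr coker_scaleDl.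

Fact coker_proj_is_linear : linear coker_proj.
Proof. by move=> a x y; rewrite coker_projD coker_projZ. Qed.

HB.instance Definition _ :=
  GRing.isLinear.Build A V coker *:%R coker_proj coker_proj_is_linear.

Lemma coker_proj_surj c : exists y, coker_proj y = c.
Proof. by exists (repr c); apply: coker_proj_repr. Qed.

Lemma coker_proj_eq0 y : coker_proj y = 0 <-> exists x, f x = y.
Proof.
rewrite -(linear0 coker_proj); split=> [/eqP|yf].
  by rewrite coker_proj_eq subr0 => /asboolP.
by apply/eqP; rewrite coker_proj_eq subr0; apply/asboolP.
Qed.

End Cokernel.

Section Modules.
Variable A : nzRingType.

Definition fin_gen (M : lmodType A) : Prop :=
  exists (r : nat) (e : 'I_r -> M),
    forall x, exists a : 'I_r -> A, x = \sum_(i < r) a i *: e i.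

Definition projective_module (P : lmodType A) : Prop :=
  forall (U V : lmodType A) (g : {linear U -> V}) (f : {linear P -> V}),
    (forall v, exists u, g u = v) ->
    exists h : {linear P -> U}, forall x, g (h x) = f x.

Definition injective_module (J : lmodType A) : Prop :=
  forall (U V : lmodType A) (i : {linear U -> V}) (f : {linear U -> J}),
    injective i ->
    exists h : {linear V -> J}, forall x, h (i x) = f x.

Definition self_injective : Prop := injective_module A^o.

Definition superfluous (P : lmodType A) (K : {pred P}) : Prop :=
  forall N : {pred P}, submod_closed N ->
    (forall x, exists u v, [/\ u \in N, v \in K & x = u + v]) ->
    forall x, x \in N.

Definition projective_cover (P C : lmodType A) (p : {linear P -> C}) : Prop :=
  [/\ projective_module P,
      forall c, exists x, p x = c
    & superfluous [pred x | p x == 0]].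

(* The differential is a family indexed by all pairs of degrees which vanishes
   outside (j + 1, j); this avoids casts along n + 1 - 1 = n. *)
Record complex := Complex {
  cobj :> int -> lmodType A;
  cdiff : forall i j, {linear cobj i -> cobj j};
  cdiff_shape : forall i j, i != j + 1 -> forall x, cdiff i j x = 0;
  cdiff_comp : forall i j l x, cdiff j l (cdiff i j x) = 0
}.

Definition acyclic (C : complex) : Prop :=
  forall n (x : C n), cdiff C n (n - 1) x = 0 ->
    exists y : C (n + 1), cdiff C (n + 1) n y = x.

Record chain_map (C D : complex) := ChainMap {
  cmap :> forall i, {linear C i -> D i};
  cmap_comm : forall i j x, cmap j (cdiff C i j x) = cdiff D i j (cmap i x)
}.

Definition homotopic (C D : complex) (f g : forall i, C i -> D i) : Prop :=
  exists h : forall i j, {linear C i -> D j},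
    (forall i j, j != i + 1 -> forall x, h i j x = 0) /\
    (forall i x, f i x - g i x =
       cdiff D (i + 1) i (h i (i + 1) x) + h (i - 1) i (cdiff C i (i - 1) x)).

Definition homotopy_equivalence (C D : complex) (f : chain_map C D) : Prop :=
  exists g : chain_map D C,
    homotopic (fun i (x : C i) => g i (f i x)) (fun i x => x) /\
    homotopic (fun i (y : D i) => f i (g i y)) (fun i y => y).

Definition chain_isomorphism (C D : complex) (f : chain_map C D) : Prop :=
  exists g : chain_map D C,
    (forall i, cancel (f i) (g i)) /\ (forall i, cancel (g i) (f i)).

Definition minimal_complex (C : complex) : Prop :=
  forall f : chain_map C C, homotopy_equivalence f -> chain_isomorphism f.

Record complete_resolution (M : lmodType A) := CompleteResolution {
  cr_complex :> complex;
  cr_acyclic : acyclic cr_complex;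
  cr_fin_gen : forall n, fin_gen (cr_complex n);
  cr_projective : forall n, projective_module (cr_complex n);
  cr_eps : {linear cr_complex 0 -> M};
  cr_eta : {linear M -> cr_complex (-1)};
  cr_factor : forall x, cdiff cr_complex 0 (-1) x = cr_eta (cr_eps x);
  cr_eps_surj : forall m, exists x, cr_eps x = m;
  cr_eta_inj : injective cr_eta
}.

Definition minimal_complete_resolution (M : lmodType A)
    (T : complete_resolution M) : Prop :=
  minimal_complex T.

End Modules.

Arguments self_injective A : clear implicits.

(* Main.v *)
(* If the image of d_(n+1) is superfluous in T_n for every n, then for any map E
   homotopic to the identity the submodule im E together with im d_(n+1) and
   h (im d_n) fills T_n, so E is onto in each degree, and bijective because T_n has
   finite k-dimension; apply this to both composites of a homotopy equivalence with
   its inverse.  Conversely, if N + im d_(n+1) = T_n, then T_(n+1) -> T_n / N is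
   onto, and lifting minus the projection T_n -> T_n / N along it gives
   h : T_n -> T_(n+1) with (1 + d h) T_n contained in N.  But 1 + d h is the degree n
   part of the chain map 1 + d h + h d, which is homotopic to the identity, hence an
   isomorphism by minimality, so that N = T_n. *)
Require Import Defs.
From HB Require Import structures.
From mathcomp Require Import all_boot all_order all_algebra all_field.
From mathcomp Require Import boolp.

Set Implicit Arguments.
Unset Strict Implicit.
Unset Printing Implicit Defensive.

Import GRing.Theory.
Local Open Scope ring_scope.

(** * Quotients by submodules and inverses of linear maps *)

Section Submodule.
Variables (A : nzRingType) (V : lmodType A) (N : {pred V}).
Hypothesis N_closed : submod_closed N.

(** The proof of closedness is an argument so that instance inference can attach a submodule
    structure to an arbitrary [N]. *)
Definition submodule_pred of submod_closed N : {pred V} := N.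

HB.instance Definition _ := GRing.isSubmodClosed.Build A V
  (submodule_pred N_closed) (GRing.submod_closed_semi N_closed).

Definition submodule : Type := {x : V | x \in submodule_pred N_closed}.

HB.instance Definition _ := SubChoice.on submodule.
HB.instance Definition _ := [SubChoice_isSubLmodule of submodule by <:].

Lemma submodule_quotient :
  exists (W : lmodType A) (q : {linear V -> W}),
    (forall w, exists v, q v = w) /\ (forall v, q v = 0 <-> v \in N).
Proof.
(* [V / N] is realised as the cokernel of the inclusion of [N]. *)
pose i : {linear submodule -> V} := \val.
exists (coker i), (coker_proj i); split=> [|v]; first exact: coker_proj_surj.
split=> [/coker_proj_eq0[x <-]|Nv]; first exact: (valP x).
by apply/coker_proj_eq0; exists (Sub v Nv : submodule).
Qed.

End Submodule.

Lemma bijective_linear_inverse (A : nzRingType) (U V : lmodType A)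
    (f : {linear U -> V}) :
    injective f -> (forall v, exists u, f u = v) ->
  exists g : {linear V -> U}, cancel f g /\ cancel g f.
Proof.
move=> f_inj f_surj; pose g v := sval (cid (f_surj v)).
have gK : cancel g f by move=> v; rewrite /g; case: cid.
have g_lin : linear g by move=> a x y; apply: f_inj; rewrite linearP !gK.
pose gM := GRing.isLinear.Build A V U *:%R g g_lin.
pose gL : {linear V -> U} := HB.pack g gM.
by exists gL; split=> // u; apply: f_inj; rewrite gK.
Qed.

(** * Finite generation over [A] as finite dimension over [k] *)

Section FiniteDimension.
Variables (k : fieldType) (A : falgType k) (M : lmodType A).

(** Scalars of [k] act on [M] through [%:A]. The subset [S] lets vectors be dropped without changing
    the index type. *)
Definition k_span (I : finType) (S : {set I}) (e : I -> M) : Prop :=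
  forall x, exists c : I -> k, x = \sum_(i in S) (c i)%:A *: e i.

(** The products of a [k]-basis of [A] with [A]-generators of [M] span [M] over [k]. *)
Lemma fin_gen_k_span : fin_gen M -> exists (I : finType) (e : I -> M),
  k_span [set: I] e.
Proof.
case=> r [e e_gen]; pose b := vbasis {:A}.
exists ('I_r * 'I_(\dim {:A}))%type.
exists (fun p : 'I_r * 'I__ => b`_p.2 *: e p.1) => x.
have [a ->] := e_gen x; exists (fun p => coord b p.2 (a p.1)).
rewrite [RHS](eq_bigl xpredT) => [|p]; last by rewrite inE.
rewrite -(pair_bigA _ (fun i j => (coord b j (a i))%:A *: (b`_j *: e i))) /=.
apply: eq_bigr => i _; rewrite [in LHS](coord_vbasis (memvf (a i))) scaler_suml.
by apply: eq_bigr => j _; rewrite scalerA mulr_algl.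
Qed.

Lemma k_span_setD1 (I : finType) (S : {set I}) (e : I -> M) (a : I -> k) i0 :
    k_span S e -> i0 \in S -> a i0 != 0 ->
    \sum_(i in S) (a i)%:A *: e i = 0 ->
  k_span (S :\ i0) e.
Proof.
move=> e_span Si0 a0 rel x; have [c ->] := e_span x.
(* Subtracting [t] times the relation cancels the coefficient of [e i0]. *)
pose t := c i0 / a i0; exists (fun i => c i - t * a i).
transitivity (\sum_(i in S) (c i - t * a i)%:A *: e i).
  have := congr1 ( *:%R t%:A) rel; rewrite /= scaler0 scaler_sumr => trel.
  rewrite -[LHS]subr0 -[X in _ - X = _]trel -sumrB.
  apply: eq_bigr => i _.
  by rewrite scalerA mulr_algl scalerA -scalerBl -scalerBl.
by rewrite (big_setD1 i0) //= /t divfK // subrr !scale0r add0r.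
Qed.

(* In a spanning family of least cardinality for M, the images under a surjection
   span too, so a nonzero kernel element would give a smaller spanning family. *)
Lemma fin_gen_surj_inj (f : {linear M -> M}) :
  fin_gen M -> (forall y, exists x, f x = y) -> injective f.
Proof.
move=> /fin_gen_k_span[I [e0 e0_span]] f_surj.
pose P m := `[< exists (S : {set I}) (e : I -> M), #|S| = m /\ k_span S e >].
have exP : exists m, P m.
  by exists #|[set: I]|; apply/asboolP; exists [set: I], e0.
case: (ex_minnP exP) => m /asboolP[S [e [Sm e_span]]] m_min.
apply: raddf_inj => x fx0; have [a x_def] := e_span x.
have f_sum c : f (\sum_(i in S) (c i)%:A *: e i)
    = \sum_(i in S) (c i)%:A *: f (e i).
  by rewrite linear_sum; apply: eq_bigr => i _; rewrite linearZ.
have fe_span : k_span S (f \o e).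
  by move=> y; have [z <-] := f_surj y; have [c ->] := e_span z; exists c.
rewrite x_def big1 // => i0 Si0; have [->|a0] := eqVneq (a i0) 0.
  by rewrite !scale0r.
suff /m_min : P #|S :\ i0| by rewrite -Sm [in leqLHS](cardsD1 i0) Si0 ltnn.
apply/asboolP; exists (S :\ i0), (f \o e); split=> //.
by apply: (k_span_setD1 (a := a)) => //=; rewrite -f_sum -x_def.
Qed.

End FiniteDimension.

Lemma superfluous_homotopic_id_surj (A : nzRingType) (P' P Q : lmodType A)
    (d' : {linear P' -> P}) (d : {linear P -> Q}) (h : {linear P -> P'})
    (h' : {linear Q -> P}) (E : {linear P -> P}) :
    superfluous [pred x | coker_proj d' x == 0] ->
    superfluous [pred x | coker_proj d x == 0] ->
    (forall x, E x - x = d' (h x) + h' (d x)) ->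
  forall y, exists x, E x = y.
Proof.
move=> d'_sup d_sup hE y.
have xE x : x = E x - d' (h x) - h' (d x).
  by rewrite -addrA -opprD -hE subKr.
pose N1 : {pred P} := fun x => `[< exists u v, x = E u + d' v >].
have N1_closed : submod_closed N1.
  split; first by apply/asboolP; exists 0, 0; rewrite !linear0 addr0.
  move=> a _ _ /asboolP[u [v ->]] /asboolP[u' [v' ->]]; apply/asboolP.
  by exists (a *: u + u'), (a *: v + v'); rewrite !linearP scalerDr addrACA.
have N1B u v : u \in N1 -> v \in N1 -> u - v \in N1.
  by move=> Nu Nv; rewrite addrC -scaleN1r; apply: N1_closed.2.
have N1_Ed x : E x - d' (h x) \in N1.
  by apply/asboolP; exists x, (- h x); rewrite linearN.
(* Once the preimage of [N1] under [h'] is all of [Q], [xE] puts every [x] in [N1]. *)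
pose N2 : {pred Q} := fun z => h' z \in N1.
have N2_closed : submod_closed N2.
  split; first by rewrite /N2 unfold_in linear0; apply: N1_closed.1.
  by move=> a u v Nu Nv; rewrite /N2 unfold_in linearP; apply: N1_closed.2.
have N2_full z : z \in N2.
  apply: (d_sup _ N2_closed) => {}z.
  (* By [xE] at [h' z], the image of [z + d (h' z)] under [h'] is [E (h' z) - d' (h (h' z))], which
     lies in [N1]. *)
  exists (z + d (h' z)), (- d (h' z)); split; last by rewrite addrK.
    rewrite /N2 unfold_in linearD [X in X + _]xE subrK; exact: N1_Ed.
  by apply/eqP/coker_proj_eq0; exists (- h' z); rewrite linearN.
have N1_full x : x \in N1.
  by rewrite [x]xE; apply: N1B => //; apply: (N2_full (d x)).
suff /asboolP : y \in lin_image E by [].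
apply: (d'_sup _ (lin_image_submod_closed E)) => x.
have /asboolP[u [v ->]] := N1_full x; exists (E u), (d' v); split=> //.
  by apply/asboolP; exists u.
by apply/eqP/coker_proj_eq0; exists v.
Qed.

(** * Chain maps obtained by deforming the identity *)

Section SingleMap.
Variables (A : nzRingType) (C : int -> lmodType A) (a b : int).
Variable g : {linear C a -> C b}.

(** Extension of [g] by zero to all pairs of degrees, the form in which [homotopic] takes a
    homotopy. *)
Definition single_map i j : {linear C i -> C j} :=
  match @eqP _ a i, @eqP _ b j with
  | ReflectT ai, ReflectT bj =>
      ecast j {linear C i -> C j} bj (ecast i {linear C i -> C b} ai g)
  | _, _ => \0
  end.

Lemma single_map_id x : single_map a b x = g x.
Proof.
rewrite /single_map; case: eqP => // ai; case: eqP => // bj.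
(* [ai] and [bj] are loops in [int], where identity proofs are unique, so both casts are trivial. *)
by rewrite !eq_axiomK.
Qed.

Lemma single_map_neq i j : (i != a) || (j != b) -> forall x, single_map i j x = 0.
Proof.
move=> ij x; rewrite /single_map; case: eqP => // ai; case: eqP => // bj.
by rewrite -ai -bj !eqxx in ij.
Qed.

End SingleMap.

Section HomotopyDeformation.
Variables (A : nzRingType) (C : complex A).
Variable h : forall i j, {linear C i -> C j}.

Definition deformation i (x : C i) : C i :=
  x + (cdiff C (i + 1) i (h i (i + 1) x) + h (i - 1) i (cdiff C i (i - 1) x)).

Fact deformation_is_linear i : linear (@deformation i).
Proof.
move=> a x y; rewrite /deformation !linearP !scalerDr.
by rewrite [X in _ + X = _]addrACA [LHS]addrACA.
Qed.

HB.instance Definition _ i := GRing.isLinear.Build A (C i) (C i) *:%R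
  (@deformation i) (@deformation_is_linear i).

Lemma deformation_comm i j (x : C i) :
  deformation (cdiff C i j x) = cdiff C i j (deformation x).
Proof.
have [i_j|i_j] := eqVneq i (j + 1); last first.
  by rewrite !cdiff_shape // (linear0 (@deformation j)).
(* As [d d = 0], both sides reduce to [d x + d h d x]; the final [addrK] identifies [j + 1 - 1] with
   [j]. *)
subst i; rewrite /deformation !linearD !cdiff_comp linear0 addr0 add0r.
by rewrite addrK.
Qed.

Definition deformation_map : chain_map C C :=
  ChainMap (cmap := fun i => @deformation i) deformation_comm.

Lemma deformation_homotopy_equivalence :
    (forall i j, j != i + 1 -> forall x, h i j x = 0) ->
  homotopy_equivalence deformation_map.
Proof.
move=> h_shape.
(* The identity is a homotopy inverse, with [h] as homotopy for both composites. *)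
exists (@ChainMap A C C (fun i => idfun) (fun i j x => erefl)).
by split; exists h; split=> // i x; rewrite /= /deformation addrC addKr.
Qed.

End HomotopyDeformation.

(** * The two implications *)

Lemma minimal_superfluous (A : nzRingType) (C : complex A) n :
    minimal_complex C -> projective_module (C n) ->
  superfluous [pred x | coker_proj (cdiff C (n + 1) n) x == 0].
Proof.
move=> C_min Cn_proj N N_closed N_sum.
have [W [q [q_surj q_ker]]] := submodule_quotient N_closed.
pose qd : {linear C (n + 1) -> W} := q \o cdiff C (n + 1) n.
pose qN : {linear C n -> W} := \- q.
have [|g gP] := Cn_proj _ _ qd qN.
  move=> w; have [v <-] := q_surj w.
  have [u [_ [Nu /eqP/coker_proj_eq0[y <-] ->]]] := N_sum v.
  by exists y; rewrite linearD ((q_ker u).2 Nu) add0r.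
have h_shape i j : j != i + 1 ->
    forall x, single_map g i j x = 0.
  move=> ij x; apply: single_map_neq.
  by have [ni|//] := eqVneq i n; rewrite -ni ij.
have [f' [_ f'K]] := C_min _ (deformation_homotopy_equivalence h_shape).
(* Every [x] is the deformation of [f' n x]. In degree [n] the deformation is [1 + d g], the [h d]
   term being zero because [n - 1] differs from [n]. *)
move=> x; rewrite -[x]f'K /= /deformation single_map_id.
rewrite [X in _ + (_ + X)]single_map_neq ?addr0; last first.
  by rewrite -subr_eq0 addrAC subrr add0r.
by apply/q_ker; rewrite linearD; have /= -> := gP (f' n x); rewrite subrr.
Qed.

Lemma superfluous_minimal (k : fieldType) (A : falgType k) (C : complex A) :
    (forall n, fin_gen (C n)) ->
    (forall n, superfluous [pred x | coker_proj (cdiff C (n + 1) n) x == 0]) ->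
  minimal_complex C.
Proof.
move=> C_fg C_sup f [g [gf_id fg_id]].
have surj (E : forall n, {linear C n -> C n}) :
    homotopic (fun i (x : C i) => E i x) (fun i x => x) ->
    forall n y, exists x, E n x = y.
  (* [subrK] turns [n - 1 + 1] into [n], so the hypothesis in degree [n - 1] concerns the
     differential leaving degree [n]. *)
  case=> h [_ hE] n; have := C_sup (n - 1); rewrite subrK => d_sup.
  exact: (superfluous_homotopic_id_surj (C_sup n) d_sup (hE n)).
(* [g f] is onto, hence injective by finite dimension, hence [f] is injective; surjectivity of [f]
   comes from [f g]. *)
have f_inj n : injective (f n).
  have gf_surj := surj (fun i => g i \o f i) gf_id n.
  exact: inj_compr (fin_gen_surj_inj (C_fg n) gf_surj).
have f_surj n y : exists x, f n x = y.
  by have [x <-] := surj (fun i => f i \o g i) fg_id n y; exists (g n x).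
pose f' n := cid (bijective_linear_inverse (f_inj n) (f_surj n)).
have fK n : cancel (f n) (sval (f' n)) by case: (f' n) => ? [].
have f'K n : cancel (sval (f' n)) (f n) by case: (f' n) => ? [].
have f'_comm i j x :
    sval (f' j) (cdiff C i j x) = cdiff C i j (sval (f' i) x).
  by apply: (f_inj j); rewrite f'K cmap_comm f'K.
by exists (ChainMap f'_comm).
Qed.

Theorem proposition2p4 (k : fieldType) (A : falgType k)
    (A_self_inj : self_injective A)
    (M : lmodType A) (M_fg : fin_gen M) (T : complete_resolution M) :
  minimal_complete_resolution T <->
  (forall n : int, projective_cover (coker_proj (cdiff T (n + 1) n))).
Proof.
split=> [T_min n|T_cover].
  split; [exact: cr_projective | exact: coker_proj_surj |].
  by apply: minimal_superfluous => //; apply: cr_projective.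
apply: superfluous_minimal => n; first exact: cr_fin_gen.
by case: (T_cover n).
Qed.
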